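(* Let $L_\psi>0$ and let $\phi:\mathbb{R}^N\to\mathbb{R}\cup\{+\infty\}$ be a proper, lower semicontinuous, $\rho$-weakly convex function with $\rho=1-\frac1{L_\psi}$ and with prox-bound $\lambda_\phi>1$. Let $\epsilon>0$ and let $g_c:\mathbb{R}^N\to\mathbb{R}^N$ be an $\epsilon$-type (c) approximation of $\mathrm{prox}_\phi$. Then $$\forall x,y\in\mathbb{R}^N,\quad \|g_c(x)-g_c(y)\|\le\frac{1}{1-\rho}\|x-y\|+\sqrt{\frac{2\epsilon}{1-\rho}} .$$
   Context: $\phi$ is $\rho$-weakly convex if $\phi+\frac{\rho}{2}\|\cdot\|^2$ is convex. The prox-bound $\lambda_\phi$ is the supremum of all $\lambda>0$ such that $\inf_{x}\{\phi(x)+\frac1{2\lambda}\|x-y\|^2\}>-\infty$ for some $y\in\mathbb{R}^N$. The proximal operator is $\mathrm{prox}_\phi(y)=\operatorname{argmin}_{x\in\mathbb{R}^N}\{\phi(x)+\frac12\|x-y\|^2\}$. For $\bar x\in\mathrm{dom}\,\phi$, the $(\rho,\epsilon)$-subdifferential is $$\partial_\epsilon^\rho\phi(\bar x)=\left\{v\in\mathbb{R}^N : \langle v,x-\bar x\rangle\le\phi(x)-\phi(\bar x)+\tfrac{\rho}{2}\|x-\bar x\|^2+\epsilon\ \text{ for all }x\in\mathbb{R}^N\right\}.$$ $g_c$ is an $\epsilon$-type (c) approximation of $\mathrm{prox}_\phi$ if $y-g_c(y)\in\partial_\epsilon^\rho\phi(g_c(y))$ for all $y\in\mathbb{R}^N$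 (in particular $g_c(y)\in\mathrm{dom}\,\phi$). *)

(* Defs.v *)
From HB Require Import structures.
From mathcomp Require Import all_boot all_order all_algebra.
From mathcomp Require Import all_classical all_reals all_analysis.
Set Implicit Arguments.
Unset Strict Implicit.
Unset Printing Implicit Defensive.
Import Order.TTheory GRing.Theory Num.Theory.
Import numFieldNormedType.Exports.
Local Open Scope classical_set_scope.
Local Open Scope ring_scope.

Definition dotr (R : realType) (N : nat) (u v : 'rV[R]_N) : R :=
  \sum_(i < N) u 0 i * v 0 i.

(* The library norm on 'rV[R]_N is the sup norm, hence this Euclidean one.
   Both induce the product topology used by lower_semicontinuous. *)
Definition enorm (R : realType) (N : nat) (u : 'rV[R]_N) : R :=
  Num.sqrt (dotr u u).

Definition edom (R : realType) (N : nat) (phi : 'rV[R]_N -> \bar R) :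
    set 'rV[R]_N :=
  [set x | (phi x < +oo)%E].

(* Not taking the value -oo is what makes phi a function into
   the reals extended by +oo only. *)
Definition eproper (R : realType) (N : nat) (phi : 'rV[R]_N -> \bar R) : Prop :=
  (forall x, (-oo < phi x)%E) /\ edom phi !=set0.

(* Jensen's inequality is meaningful up to the endpoints since 0 * +oo = 0
   in \bar R; it is intended for functions that do not take the value -oo. *)
Definition econvex (R : realType) (N : nat) (f : 'rV[R]_N -> \bar R) : Prop :=
  forall (x y : 'rV[R]_N) (t : R), 0 <= t <= 1 ->
    (f (t *: x + (1 - t) *: y)%R <= t%:E * f x + (1 - t)%:E * f y)%E.

Definition weakly_convex (R : realType) (N : nat) (rho : R)
    (phi : 'rV[R]_N -> \bar R) : Prop :=
  econvex (fun x => (phi x + (rho / 2 * enorm x ^+ 2)%:E)%E).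

Definition prox_bound (R : realType) (N : nat) (phi : 'rV[R]_N -> \bar R) :
    \bar R :=
  ereal_sup [set lambda%:E | lambda in [set lambda : R | 0 < lambda /\
    exists y : 'rV[R]_N,
      (-oo < ereal_inf (range (fun x : 'rV[R]_N =>
         phi x + (1 / (2 * lambda) * enorm (x - y) ^+ 2)%:E)))%E]].

(* Empty when xbar lies outside the domain of phi. *)
Definition subdiff (R : realType) (N : nat) (rho eps : R)
    (phi : 'rV[R]_N -> \bar R) (xbar : 'rV[R]_N) : set 'rV[R]_N :=
  [set v | edom phi xbar /\ forall x : 'rV[R]_N,
    ((dotr v (x - xbar))%:E <=
       phi x - phi xbar + (rho / 2 * enorm (x - xbar) ^+ 2)%:E + eps%:E)%E].

(* An eps-type (c) approximation g of the proximal operator of phi; the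
   weak convexity modulus rho of phi is a parameter of this notion. *)
Definition type_c_prox_approx (R : realType) (N : nat) (rho eps : R)
    (phi : 'rV[R]_N -> \bar R) (g : 'rV[R]_N -> 'rV[R]_N) : Prop :=
  forall y : 'rV[R]_N, subdiff rho eps phi (g y) (y - g y).

(* Main.v *)
Require Import Defs.
From HB Require Import structures.
From mathcomp Require Import all_boot all_order all_algebra.
From mathcomp Require Import all_classical all_reals all_analysis.
From mathcomp Require Import ring lra.
Import Order.TTheory GRing.Theory Num.Theory.
Import numFieldNormedType.Exports.
Local Open Scope classical_set_scope.
Local Open Scope ring_scope.

(** The (rho, eps)-subdifferential is almost rho-hypomonotone: adding the two
    subgradient inequalities at [a] and [b], each tested at the other point,
    cancels the values of [phi] and leaves
    [<u - v, a - b> >= - rho |a - b|^2 - 2 eps] ([subdiff_hypomonotone]).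
    For [a = g_c x], [b = g_c y], [u = x - a], [v = y - b], this reads
    [(1 - rho) |a - b|^2 <= <x - y, a - b> + 2 eps].  By Cauchy-Schwarz
    ([dotr_le_enorm]) the distance [d = |a - b|] satisfies a quadratic
    inequality [s d^2 <= r d + 2 eps], where [s = 1 - rho > 0] and
    [r = |x - y|], and the claimed estimate is an upper bound for its larger
    root ([quadratic_bound]). *)

Lemma dotrC (R : realType) (N : nat) (u v : 'rV[R]_N) : dotr u v = dotr v u.
Proof. by apply: eq_bigr => i _; rewrite mulrC. Qed.

Lemma dotrDl (R : realType) (N : nat) (u v w : 'rV[R]_N) :
  dotr (u + v) w = dotr u w + dotr v w.
Proof. by rewrite -big_split; apply: eq_bigr => i _; rewrite mxE mulrDl. Qed.

Lemma dotrZl (R : realType) (N : nat) (a : R) (u v : 'rV[R]_N) :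
  dotr (a *: u) v = a * dotr u v.
Proof. by rewrite mulr_sumr; apply: eq_bigr => i _; rewrite mxE mulrA. Qed.

Lemma dotrNl (R : realType) (N : nat) (u v : 'rV[R]_N) :
  dotr (- u) v = - dotr u v.
Proof. by rewrite -scaleN1r dotrZl mulN1r. Qed.

Lemma dotr_ge0 (R : realType) (N : nat) (u : 'rV[R]_N) : 0 <= dotr u u.
Proof. by apply: sumr_ge0 => i _; rewrite -expr2 sqr_ge0. Qed.

Lemma enorm_ge0 (R : realType) (N : nat) (u : 'rV[R]_N) : 0 <= enorm u.
Proof. exact: sqrtr_ge0. Qed.

Lemma sqr_enorm (R : realType) (N : nat) (u : 'rV[R]_N) :
  enorm u ^+ 2 = dotr u u.
Proof. by rewrite sqr_sqrtr // dotr_ge0. Qed.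

Lemma enormN (R : realType) (N : nat) (u : 'rV[R]_N) : enorm (- u) = enorm u.
Proof. by rewrite /enorm dotrNl dotrC dotrNl opprK. Qed.

Lemma enorm_eq0 (R : realType) (N : nat) (u : 'rV[R]_N) :
  enorm u = 0 -> u = 0.
Proof.
move=> u0; have /eqP : dotr u u = 0 by rewrite -sqr_enorm u0 expr0n.
rewrite psumr_eq0 => [/allP z|i _]; last by rewrite -expr2 sqr_ge0.
apply/rowP => i; apply/eqP; rewrite mxE.
by have := z i (mem_index_enum i); rewrite /= mulf_eq0 orbb.
Qed.

(** Cauchy-Schwarz: the vector [|v| u - |u| v] has the nonnegative squared
    length [2 |u| |v| (|u| |v| - <u, v>)]. *)
Lemma dotr_le_enorm (R : realType) (N : nat) (u v : 'rV[R]_N) :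
  dotr u v <= enorm u * enorm v.
Proof.
have dot0 (w : 'rV[R]_N) : dotr 0 w = 0 by rewrite -(scale0r w) dotrZl mul0r.
have [/enorm_eq0 ->|u0] := eqVneq (enorm u) 0.
  by rewrite dot0 mulr_ge0 // enorm_ge0.
have [/enorm_eq0 ->|v0] := eqVneq (enorm v) 0.
  by rewrite dotrC dot0 mulr_ge0 // enorm_ge0.
have uv0 : 0 < enorm u * enorm v.
  by rewrite mulr_gt0 // lt_def ?u0 ?v0 enorm_ge0.
have := dotr_ge0 _ _ (enorm v *: u - enorm u *: v).
rewrite dotrDl dotrNl !dotrZl ![dotr _ (_ - _)]dotrC !dotrDl !dotrNl !dotrZl.
rewrite -!sqr_enorm [dotr v u]dotrC => h.
rewrite -(ler_pM2l uv0); lra.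
Qed.

(** [phi a] and [phi b] are finite, so they cancel in the sum of the inequality
    for [u] tested at [b] and the inequality for [v] tested at [a]. *)
Lemma subdiff_hypomonotone (R : realType) (N : nat) (rho eps : R)
    (phi : 'rV[R]_N -> \bar R) (a b u v : 'rV[R]_N) :
  (forall x, (-oo < phi x)%E) ->
  subdiff rho eps phi a u -> subdiff rho eps phi b v ->
  - (rho * enorm (a - b) ^+ 2) - 2 * eps <= dotr (u - v) (a - b).
Proof.
move=> phiNy [da /(_ b) ha] [db /(_ a) hb].
move: da db (phiNy a) (phiNy b) ha hb; rewrite /edom /=.
case: (phi a) => [pa||] //; case: (phi b) => [pb||] // _ _ _ _.
rewrite !lee_fin -(opprB a b) enormN [dotr u _]dotrC dotrNl [dotr _ u]dotrC.
rewrite dotrDl dotrNl; lra.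
Qed.

(** If [d] exceeded [r / s + q] with [q = sqrt (c / s)], then both factors of
    [d (d - r / s) <= q^2] would exceed [q]. *)
Lemma quadratic_bound (R : realType) (s r c d : R) :
  0 < s -> 0 <= r -> 0 <= c -> s * d ^+ 2 <= r * d + c ->
  d <= 1 / s * r + Num.sqrt (c / s).
Proof.
move=> s0 r0 c0 h; rewrite leNgt; apply/negP => hd.
set q := Num.sqrt (c / s) in hd.
have q0 : 0 <= q by exact: sqrtr_ge0.
have qE : s * q ^+ 2 = c.
  by rewrite sqr_sqrtr ?divr_ge0 ?(ltW s0) // mulrC divfK ?gt_eqF.
set k := 1 / s * r in hd.
have kE : s * k = r by rewrite /k mul1r mulVKf ?gt_eqF.
have k0 : 0 <= k by rewrite mulr_ge0 // divr_ge0 ?ltW.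
move: h; rewrite -qE -kE -mulrA -mulrDr ler_pM2l //; nra.
Qed.

Theorem proposition10 (R : realType) (N : nat) (Lpsi rho eps : R)
  (phi : 'rV[R]_N -> \bar R) (g_c : 'rV[R]_N -> 'rV[R]_N)
  (hL : 0 < Lpsi)
  (hrho : rho = 1 - 1 / Lpsi)
  (hproper : eproper phi)
  (hlsc : lower_semicontinuous phi)
  (hwc : weakly_convex rho phi)
  (hpb : (1%:E < prox_bound phi)%E)
  (heps : 0 < eps)
  (hg : type_c_prox_approx rho eps phi g_c) :
  forall x y : 'rV[R]_N,
    enorm (g_c x - g_c y) <=
      1 / (1 - rho) * enorm (x - y) + Num.sqrt (2 * eps / (1 - rho)).
Proof.
move=> x y; have s0 : 0 < 1 - rho.
  by rewrite hrho opprB addrC subrK divr_gt0.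
apply: quadratic_bound; rewrite ?enorm_ge0 ?mulr_ge0 ?(ltW heps) //.
have := subdiff_hypomonotone _ _ _ _ _ _ _ _ _ hproper.1 (hg x) (hg y).
have -> : x - g_c x - (y - g_c y) = (x - y) - (g_c x - g_c y).
  by rewrite !opprB addrACA [RHS]addrACA [- g_c x + _]addrC.
rewrite [dotr (_ - _ - _) _]dotrDl dotrNl -sqr_enorm.
have := dotr_le_enorm _ _ (x - y) (g_c x - g_c y); lra.
Qed.
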